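(* Let $G$ be a finite simple connected non-trivial graph (i.e. having at least two vertices) of order $n$, without pendent vertices. Then $$ABC(G)\le ABS(G),$$ with equality if and only if $G\cong C_n$, where $C_n$ is the $n$-vertex cycle.
   Context: For a finite simple graph $G$ with edge set $\mathbf{E}(G)$, let $d_u$ denote the degree of the vertex $u$ in $G$. The atom-bond-connectivity index is $ABC(G)=\sum_{uv\in \mathbf{E}(G)}\sqrt{\frac{d_u+d_v-2}{d_u d_v}}$ and the atom-bond sum-connectivity index is $ABS(G)=\sum_{uv\in \mathbf{E}(G)}\sqrt{\frac{d_u+d_v-2}{d_u+d_v}}$. A pendent vertex is a vertex of degree one. The order of a graph is its number of vertices. *)

(* Defs.v *)
From mathcomp Require Import all_boot all_order all_algebra.

Set Implicit Arguments.
Unset Strict Implicit.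
Unset Printing Implicit Defensive.

Import Order.TTheory GRing.Theory Num.Theory.
Local Open Scope ring_scope.

Record sgraph := SGraph {
  vertex :> finType;
  adj : rel vertex;
  adj_sym : symmetric adj;
  adj_irr : irreflexive adj
}.

Definition edges (G : sgraph) : {set {set G}} :=
  [set [set p.1; p.2] | p : G * G & adj p.1 p.2].

Definition deg (G : sgraph) (u : G) : nat := #|[set v | adj u v]|.

Definition connected (G : sgraph) : Prop :=
  forall u v : G, connect (@adj G) u v.

Definition pendent (G : sgraph) (u : G) : bool := deg u == 1%N.

(* For an edge E = {u, v} (u != v), the sum and the product over E are
   d_u + d_v and d_u * d_v. *)
Definition ABC (R : rcfType) (G : sgraph) : R :=
  \sum_(E in edges G)
    Num.sqrt (((\sum_(u in E) (deg u)%:R) - 2) / \prod_(u in E) (deg u)%:R).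

Definition ABS (R : rcfType) (G : sgraph) : R :=
  \sum_(E in edges G)
    Num.sqrt (((\sum_(u in E) (deg u)%:R) - 2) / \sum_(u in E) (deg u)%:R).

(* ordS is the successor modulo n, so this is the n-vertex cycle for n >= 3;
   the conjunct i != j only matters for n = 1, where it removes the loop. *)
Definition cycle_adj (n : nat) : rel 'I_n :=
  fun i j => (i != j) && ((j == ordS i) || (i == ordS j)).

Lemma cycle_adj_sym (n : nat) : symmetric (@cycle_adj n).
Proof. by move=> i j; rewrite /cycle_adj eq_sym orbC. Qed.

Lemma cycle_adj_irr (n : nat) : irreflexive (@cycle_adj n).
Proof. by move=> i; rewrite /cycle_adj eqxx. Qed.

Definition cycle_graph (n : nat) : sgraph :=
  SGraph (@cycle_adj_sym n) (@cycle_adj_irr n).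

Definition isomorphic (G H : sgraph) : Prop :=
  exists2 f : G -> H, bijective f & forall u v : G, adj (f u) (f v) = adj u v.

(* Main.v *)
Require Import Defs.
From mathcomp Require Import all_boot all_order all_algebra.
From mathcomp Require Import zify ring lra.

(** In a connected graph of order at least two without pendent vertices all
    degrees are at least 2, and [x + y <= x * y] for [x, y >= 2], with equality
    only for [x = y = 2]; so the inequality holds edge by edge, and equality of
    the sums means that the graph is 2-regular.  A walk in a 2-regular graph
    which never backtracks must first meet itself at its starting point, hence
    closes up into a cycle; its vertices exhaust the graph by connectedness. *)

Set Implicit Arguments.
Unset Strict Implicit.
Unset Printing Implicit Defensive.

Import Order.TTheory GRing.Theory Num.Theory.
Local Open Scope ring_scope.

Lemma abc_abs_weight_leif (R : rcfType) (x y : R) : 2 <= x -> 2 <= y ->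
  Num.sqrt ((x + y - 2) / (x * y)) <= Num.sqrt ((x + y - 2) / (x + y))
    ?= iff (x == 2) && (y == 2).
Proof.
move=> x2 y2.
have num_gt0 : 0 < x + y - 2 by lra.
have D_gt0 : 0 < x + y by lra.
have M_gt0 : 0 < x * y by rewrite mulr_gt0 //; lra.
(* Expanding gives [x * y >= 2 * (x + y) - 4], which is at least [x + y] because [x + y >= 4]; if
   [x + y = x * y], it forces [x + y <= 4], hence [x = y = 2]. *)
have prod_ge0 : 0 <= (x - 2) * (y - 2) by rewrite mulr_ge0 // subr_ge0.
have DM : x + y <= x * y by lra.
split; first by rewrite ler_wsqrtr // ler_pM2l // lef_pV2.
rewrite eqr_sqrt ?divr_ge0 ?(ltW num_gt0) ?(ltW D_gt0) ?(ltW M_gt0) //.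
rewrite (inj_eq (mulfI (lt0r_neq0 num_gt0))) (inj_eq invr_inj).
apply/eqP/andP => [eqMD|[/eqP-> /eqP->]]; last by ring.
by split; apply/eqP; lra.
Qed.

Lemma edge_adj_leif (R : rcfType) (G : sgraph) (E : {set G}) :
    (forall u : G, 2 <= deg u)%N -> E \in edges G ->
  Num.sqrt (((\sum_(u in E) (deg u)%:R) - 2) / \prod_(u in E) (deg u)%:R)
    <= Num.sqrt (((\sum_(u in E) (deg u)%:R) - 2) / \sum_(u in E) (deg u)%:R)
    ?= iff [forall u in E, deg u == 2%N] :> R.
Proof.
move=> deg2 /imsetP[[u v]]; rewrite inE /= => uv ->.
(* Distinct endpoints make the sum and the product over the set have exactly two terms. *)
have neq_uv : u \notin [set v].
  by rewrite inE; apply: contraTneq uv => ->; rewrite adj_irr.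
rewrite !big_setU1 //= !big_set1.
have -> : [forall w in [set u; v], deg w == 2%N]
       = ((deg u)%:R == 2 :> R) && ((deg v)%:R == 2 :> R).
  rewrite !eqr_nat; apply/forall_inP/andP => [H|[du dv] w].
    by rewrite !H ?set21 ?set22.
  by move=> /set2P[->|->].
by apply: abc_abs_weight_leif; rewrite ler_nat.
Qed.

Lemma deg_gt0 (G : sgraph) (u : G) :
  connected G -> (1 < #|G|)%N -> (0 < deg u)%N.
Proof.
move=> conn; rewrite (cardD1 u) ltnS => /card_gt0P[v /andP[/= vu _]].
have /connectP[[|w q]] := conn u v; first by move=> _ vE; rewrite vE eqxx in vu.
by move=> /= /andP[uw _] _; apply/card_gt0P; exists w; rewrite inE.
Qed.

Lemma isomorphic_deg (G H : sgraph) (f : G -> H) (u : G) :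
    injective f -> (forall u v : G, adj (f u) (f v) = adj u v) ->
  (deg u <= deg (f u))%N.
Proof.
move=> inj_f adj_f; rewrite /deg -(card_imset _ inj_f).
by apply/subset_leq_card/subsetP=> _ /imsetP[v + ->]; rewrite !inE adj_f.
Qed.

(** An upper bound, valid for every [n], suffices for the converse: the degrees in [G] are already
    at least 2. *)
Lemma cycle_graph_deg (n : nat) (i : cycle_graph n) : (deg i <= 2)%N.
Proof.
apply: (@leq_trans #|[set ordS i; ord_pred i]|); last by rewrite cards2; case: eqP.
apply/subset_leq_card/subsetP=> j; rewrite !inE /= => /andP[_].
by case/orP=> /eqP->; rewrite ?ordSK eqxx ?orbT.
Qed.

(** The vertex [w] is where a walk entering [v] from [u] must go next. The boolean form lets [pick]
    select it. *)
Lemma deg2_other (G : sgraph) (u v : G) : deg v = 2%N -> adj u v ->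
  exists w, (w != u) && [forall x, adj v x == ((x == u) || (x == w))].
Proof.
rewrite /deg => /eqP/cards2P[a [b [ab Nv]]] uv.
have vE x : adj v x = (x == a) || (x == b).
  by have /setP/(_ x) := Nv; rewrite !inE.
have : adj v u by rewrite adj_sym.
rewrite vE => /orP[]/eqP->; [exists b | exists a].
  by rewrite eq_sym ab; apply/forallP=> x; rewrite vE.
by rewrite ab; apply/forallP=> x; rewrite vE orbC.
Qed.

(** The second clause encodes both the adjacency of consecutive vertices and the absence of a third
    neighbour, at every vertex [p k.+1]. *)
Definition nb_walk (G : sgraph) (p : nat -> G) : Prop :=
  (forall k, p k.+2 != p k) /\
  (forall k x, adj (p k.+1) x = (x == p k) || (x == p k.+2)).

Lemma deg2_nb_walk (G : sgraph) (u0 : G) :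
  (forall u : G, deg u = 2%N) -> exists p : nat -> G, nb_walk p.
Proof.
move=> deg2.
(* A state of the walk is a directed edge. The default [u0] is never returned on such states, by
   [deg2_other]. *)
pose nx (d : G * G) := odflt u0
  [pick w | (w != d.1) && [forall x, adj d.2 x == ((x == d.1) || (x == w))]].
have nxP (d : G * G) : adj d.1 d.2 ->
    nx d != d.1 /\ forall x, adj d.2 x = (x == d.1) || (x == nx d).
  move=> ad; rewrite /nx; case: pickP => [w /andP[wd /forallP H]|no] /=.
    by split=> // x; apply/eqP.
  by have [w] := deg2_other (deg2 d.2) ad; rewrite no.
have [u1 u01] : exists u1, adj u0 u1.
  have : (0 < deg u0)%N by rewrite deg2.
  by case/card_gt0P=> u1; rewrite inE; exists u1.
pose walk k := iter k (fun d => (d.2, nx d)) (u0, u1).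
have walk_adj k : adj (walk k).1 (walk k).2.
  by elim: k => //= k /nxP[_ ->]; rewrite eqxx orbT.
exists (fun k => (walk k).1); split=> k /=; first by have [] := nxP _ (walk_adj k).
by move=> x; have [_ ->] := nxP _ (walk_adj k).
Qed.

Section NonBacktrackingWalk.
Variables (G : sgraph) (p : nat -> G).
Hypothesis walk_p : nb_walk p.

Let nback k : p k.+2 != p k. Proof. by case: walk_p. Qed.
Let adjE k x : adj (p k.+1) x = (x == p k) || (x == p k.+2).
Proof. by case: walk_p. Qed.

Lemma nb_walk_adj k : adj (p k) (p k.+1).
Proof. by rewrite adj_sym adjE eqxx. Qed.

Lemma nb_walk_neq k : p k != p k.+1.
Proof. by apply: contraTneq (nb_walk_adj k) => <-; rewrite adj_irr. Qed.

Lemma nb_walk_return :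
  exists m, [/\ (2 < m)%N, {in gtn m &, injective p} & p m = p 0].
Proof.
(* By pigeonhole some prefix has a repetition; in the shortest one, only the last vertex repeats an
   earlier one. *)
have exm : exists m, ~~ uniq (mkseq p m).
  exists #|G|.+1; apply/negP=> /card_uniqP; rewrite size_mkseq => cardE.
  by have := max_card (mem (mkseq p #|G|.+1)); rewrite cardE ltnn.
case: (ex_minnP exm) => -[|m] //; rewrite mkseqS rcons_uniq => Pm min_m.
have uniq_m : uniq (mkseq p m).
  by apply/idPn => /min_m; rewrite ltnn.
have inj_p : {in gtn m &, injective p} by apply/mkseq_uniqP.
exists m; rewrite uniq_m andbT negbK in Pm.
case/mapP: Pm => i; rewrite mem_iota add0n => /= im pmi.
(* A return after one step would be a loop, and after two steps a backtrack. *)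
have im1 : (i.+1 < m)%N.
  rewrite ltn_neqAle im andbT; apply/eqP=> mE.
  by have := nb_walk_neq i; rewrite mE pmi eqxx.
have im2 : (i.+2 < m)%N.
  rewrite ltn_neqAle im1 andbT; apply/eqP=> mE.
  by have := nback i; rewrite mE pmi eqxx.
case: i => [|i] in im im1 im2 pmi *; first by split.
(* A first return to a vertex other than [p 0] would give it a third neighbour. *)
have : adj (p i.+1) (p m.-1).
  by rewrite -pmi adj_sym -{2}(ltn_predK im) nb_walk_adj.
rewrite adjE => /orP[]/eqP/inj_p; rewrite !inE => mE; lia.
Qed.

(** Two consecutive vertices determine the rest of the walk, so it is enough that [p m.+1 = p 1].
    Now [p 1] is a neighbour of [p m], and it is not [p m.-1] by injectivity, as [m > 2]. *)
Lemma nb_walk_mod m k : (2 < m)%N -> {in gtn m &, injective p} -> p m = p 0 ->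
  p (k %% m) = p k.
Proof.
move=> m_gt2 inj_p pm0.
have per j : p (j + m) = p j /\ p (j.+1 + m) = p j.+1.
  elim: j => [|j [IH0 IH1]].
    split; first exact: pm0.
    have := nb_walk_adj 0; rewrite -pm0 -{1}(ltn_predK m_gt2) adjE.
    rewrite (ltn_predK m_gt2) add1n => /orP[]/eqP// /inj_p; rewrite !inE => mE; lia.
  split=> //; have := nb_walk_adj (j.+1 + m); rewrite IH1 adjE.
  by have := nback (j + m); rewrite IH0 -!addSn => /negbTE-> /= /eqP.
rewrite {2}(divn_eq k m); elim: (k %/ m)%N => [|q ->] //.
by rewrite mulSn -addnA [(m + _)%N]addnC (per _).1.
Qed.

Lemma nb_walk_cycle : connected G -> isomorphic G (cycle_graph #|G|).
Proof.
move=> conn; have [m [m_gt2 inj_p pm0]] := nb_walk_return.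
have modE k : p (k %% m) = p k by apply: nb_walk_mod.
pose f (i : 'I_m) : G := p i.
have inj_f : injective f by move=> i j /inj_p ij; apply/val_inj/ij; rewrite inE.
have fS i : f (ordS i) = p i.+1 by rewrite /f /= modE.
have fSS i : f (ordS (ordS i)) = p i.+2.
  by rewrite fS -modE /= -addn1 modnDml addn1 modE.
(* Every index modulo [m] is a successor, so this form also covers [f] at index 0, whereas [adjE]
   only describes the neighbours of [p k.+1]. *)
have adjfS i x : adj (f (ordS i)) x = (x == f i) || (x == f (ordS (ordS i))).
  by rewrite fSS fS adjE.
have adjf i j : adj (f i) (f j) = cycle_adj i j.
  rewrite /cycle_adj; have [->|_] /= := eqVneq i j; first by rewrite adj_irr.
  rewrite -{1}(ord_predK i) adjfS ord_predK !(inj_eq inj_f) orbC; congr (_ || _).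
  by rewrite -(can2_eq (@ordSK m) (@ord_predK m)) eq_sym.
(* The visited vertices form a union of connected components. *)
have closed_f : closed (@adj G) (codom f).
  apply: intro_closed; first exact/sym_connect_sym/adj_sym.
  move=> x y + /codomP[i xE]; rewrite xE -(ord_predK i) adjfS.
  by case/orP=> /eqP->; apply: codom_f.
have surj_f x : x \in codom f.
  pose i0 := Ordinal (ltn_trans (isT : 0 < 2)%N m_gt2).
  by rewrite -(closed_connect closed_f (conn (f i0) x)) codom_f.
have cardG : #|G| = m.
  have /eq_card <- : codom f =i G by move=> x; rewrite surj_f.
  by rewrite card_codom // card_ord.
rewrite cardG; have [g fK gK] : bijective f.
  by apply: inj_card_bij => //; rewrite cardG card_ord.
exists g; first by exists f.
by move=> u v; rewrite -[in RHS](gK u) -[in RHS](gK v) adjf.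
Qed.

End NonBacktrackingWalk.

Theorem proposition2p1 (R : rcfType) (G : sgraph) (n : nat)
    (order_G : #|G| = n) (nontrivial_G : (1 < n)%N)
    (connected_G : connected G)
    (no_pendent : forall u : G, ~~ pendent u) :
  ABC R G <= ABS R G /\
  (ABC R G = ABS R G <-> isomorphic G (cycle_graph n)).
Proof.
subst n.
have deg2 (u : G) : (2 <= deg u)%N.
  by rewrite ltn_neqAle eq_sym no_pendent deg_gt0.
have [le_sum eq_sum] := leif_sum (fun E => @edge_adj_leif R G E deg2).
split; first exact: le_sum.
split=> [/eqP|[f bij_f adj_f]].
  rewrite eq_sum => /forall_inP all2.
  have reg (u : G) : deg u = 2%N.
    (* Equality is known on edges only; [u] has a neighbour, so it lies on one. *)
    have /card_gt0P[v] := ltnW (deg2 u); rewrite inE => uv.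
    have uvE : [set u; v] \in edges G by apply/imsetP; exists (u, v); rewrite ?inE.
    by have /forall_inP/(_ u (set21 u v))/eqP := all2 _ uvE.
  have /card_gt0P[u0 _] := ltnW nontrivial_G.
  by have [p /nb_walk_cycle] := deg2_nb_walk u0 reg; apply.
apply/eqP; rewrite eq_sum; apply/forall_inP=> E _; apply/forall_inP=> u _.
rewrite eqn_leq deg2 andbT.
exact: leq_trans (isomorphic_deg u (bij_inj bij_f) adj_f) (cycle_graph_deg _).
Qed.
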